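(* Consider the partially quantized gossip algorithm with probabilistic quantizer $q_p$: at each time $t$, when the edge $(i,j)$ is selected, $$x_i(t+1)= \tfrac12 x_i(t)+\tfrac12 q_p(x_j(t)),\qquad x_j(t+1)= \tfrac12 x_j(t)+\tfrac12 q_p(x_i(t)),$$ and $x_h(t+1)=x_h(t)$ for $h\ne i,j$, starting from a given $x(0)\in\mathbb{R}^N$. Then there exists an integer-valued random variable $\alpha$ such that $\mathbb{E}[\alpha]=x_{\mathrm{ave}}(0)$ and, almost surely, $$\lim_{t\to\infty}x_i(t)=\alpha\quad\text{for all } i\in\{1,\dots,N\}.$$
   Context: Let $\mathcal{G}=(\mathcal{V},\mathcal{E})$ be an undirected connected graph with node set $\mathcal{V}=\{1,\dots,N\}$, whose edges join distinct nodes. At each time $t\in\mathbb{Z}_{\ge0}$ one edge $(i,j)\in\mathcal{E}$ is randomly selected, with probability $W^{(i,j)}>0$, where $\sum_{(i,j)\in\mathcal{E}}W^{(i,j)}=1$. Selections at different times are independent, and the edge selected at time $t$ is independent of $x(t)$ and of the quantization randomness. Let $x_{\mathrm{ave}}(t)=\frac1N\sum_{i=1}^N x_i(t)$. The probabilistic quantizer: for $x\in\mathbb{R}$, $q_p(x)$ is the random integer equal to $\lfloor x\rfloor$ with probability $\lceil x\rceil-x$ and to $\lceil x\rceil$ with probability $x-\lfloor x\rfloor$ (and $q_p(x)=x$ if $x\in\mathbb{Z}$). Standing independence assumption: for all $t\ge0$, given the values $x_i(t)$ for all $i\in\mathcal{V}$ (and the past), the random variables $q_p(x_i(t))$, as $i$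 varies, are independent; moreover, given the value $x_i(t)$ for any $i$, the random variable $q_p(x_i(t))$ is independent of $x_j(t)$ for every $j\ne i$. *)

(* Defs.v *)
From HB Require Import structures.
From mathcomp Require Import all_boot all_order all_algebra.
From mathcomp Require Import all_classical all_reals all_analysis.

Set Implicit Arguments.
Unset Strict Implicit.
Unset Printing Implicit Defensive.

Import Order.TTheory GRing.Theory Num.Theory.
Import numFieldNormedType.Exports.

Local Open Scope classical_set_scope.
Local Open Scope ring_scope.

(** Undirected simple graphs on [V], given by their edge set: an edge is the
    two-element set of its endpoints. *)
Definition simple_graph (V : finType) (E : {set {set V}}) : Prop :=
  forall e, e \in E -> #|e| = 2%N.

Definition adjacent (V : finType) (E : {set {set V}}) : rel V :=
  fun i j => [set i; j]%SET \in E.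

Definition connected_graph (V : finType) (E : {set {set V}}) : Prop :=
  forall i j : V, connect (adjacent E) i j.

(** Probability that the random integer [q_p(x)] equals [k].  The case of an
    integer [x] is separate: there floor and ceiling agree and the two weights
    [ceil x - x] and [x - floor x] both vanish. *)
Definition quantizer_prob (R : realType) (x : R) (k : int) : R :=
  if x \is a Num.int then (k%:~R == x)%:R
  else if k == Num.floor x then (Num.ceil x)%:~R - x
  else if k == Num.ceil x then x - (Num.floor x)%:~R
  else 0.

Definition average (R : realType) (N : nat) (x : 'I_N -> R) : R :=
  (\sum_(i < N) x i) / N%:R.

Section Conditioning.
Context d (T : measurableType d) (R : realType) (P : probability T R).

(** [g] is a version of the conditional probability [P(B | F)], for [F] a
    sub-sigma-algebra of the measurable sets of [T]. *)
Definition cond_probability_version (F : set (set T)) (B : set T)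
    (g : T -> R) : Prop :=
  (forall U : set R, measurable U -> F (g @^-1` U)) /\
  (forall A, F A -> (\int[P]_(w in A) (g w)%:E = P (A `&` B))%E).

Definition cond_mutually_independent (F : set (set T)) (I : finType)
    (X : I -> {RV P >-> R}) : Prop :=
  forall (J : {set I}) (U : I -> set R) (g : I -> T -> R),
    (forall i, i \in J -> measurable (U i)) ->
    (forall i, i \in J ->
       cond_probability_version F (X i @^-1` U i) (g i)) ->
    cond_probability_version F (\bigcap_(i in [set` J]) (X i @^-1` U i))
      (fun w => \prod_(i in J) g i w).

Definition independent_of (F : set (set T)) (S : finType) (Y : T -> S) : Prop :=
  forall (A : set T) (s : S), F A ->
    (P (A `&` Y @^-1` [set s]) = P A * P (Y @^-1` [set s]))%E.

(** Sigma-algebra generated by the states [x s] for [s < nx], the quantized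
    states [q s] for [s < nq] and the selected edges [sel s] for [s < ns]. *)
Definition observed (N : nat) (x q : nat -> 'I_N -> {RV P >-> R})
    (sel : nat -> T -> {set 'I_N}) (nx nq ns : nat) : set (set T) :=
  <<s [set A | (exists s i U, [/\ (s < nx)%N, measurable U &
                                  A = x s i @^-1` U])
            \/ (exists s i U, [/\ (s < nq)%N, measurable U &
                                  A = q s i @^-1` U])
            \/ (exists s e, (s < ns)%N /\ A = sel s @^-1` [set e])] >>.

End Conditioning.

(** The last clause makes [sel t] independent of the earlier edges as well as of
    the states and quantized values up to time [t]; mutual independence of all
    the [sel t] follows by induction. *)
Definition random_edge_selection d (T : measurableType d) (R : realType)
    (P : probability T R) (N : nat) (E : {set {set 'I_N}})
    (W : {set 'I_N} -> R) (x q : nat -> 'I_N -> {RV P >-> R})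
    (sel : nat -> T -> {set 'I_N}) : Prop :=
  [/\ forall t w, sel t w \in E,
      forall t e, measurable (sel t @^-1` [set e]),
      forall t e, e \in E -> P (sel t @^-1` [set e]) = (W e)%:E &
      forall t, independent_of P (observed x q sel t.+1 t.+1 t) (sel t)].

(** [q t i] is the random variable [q_p(x_i(t))].  Given [x(t)] and the past,
    its law depends on [x_i(t)] only and is the law of [q_p] at [x_i(t)], and
    the variables [q t i], [i] varying, are independent. *)
Definition probabilistic_quantization d (T : measurableType d) (R : realType)
    (P : probability T R) (N : nat) (x q : nat -> 'I_N -> {RV P >-> R})
    (sel : nat -> T -> {set 'I_N}) : Prop :=
  [/\ forall t i w, q t i w \is a Num.int,
      forall t i (k : int),
        cond_probability_version P (observed x q sel t.+1 t t)
          (q t i @^-1` [set k%:~R])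
          (fun w => quantizer_prob (x t i w) k) &
      forall t, cond_mutually_independent (observed x q sel t.+1 t t) (q t)].

Definition partially_quantized_gossip (T : Type) (R : realType) (N : nat)
    (x q : nat -> 'I_N -> T -> R) (sel : nat -> T -> {set 'I_N}) : Prop :=
  forall t w,
    (forall i j, i != j -> sel t w = [set i; j]%SET ->
       x t.+1 i w = 2^-1 * x t i w + 2^-1 * q t j w /\
       x t.+1 j w = 2^-1 * x t j w + 2^-1 * q t i w) /\
    (forall h, h \notin sel t w -> x t.+1 h w = x t h w).

(* Main.v *)
(** The state [x t] takes finitely many values almost surely, because [x 0] is
    deterministic and the quantized values are bounded integers, so conditional
    expectations reduce to finite combinations of conditional probabilities.
    Quantization adds to [x_i] a centered noise of conditional variance
    [v_i = f (1 - f)], [f] the fractional part of [x_i], and the noises of the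
    two endpoints of an edge are uncorrelated.  Hence, for [S = sum_i x_i], the
    function [sum_i x_i^2 - 2 S^2] has expected drift
    [- ((x_i - x_j)^2 / 2 + (v_i + v_j) / 4)] when the edge [{i, j}] is selected:
    the noise raises [S^2] enough to outweigh its effect on [sum_i x_i^2].
    As this function is bounded, the expectations of these quantities are
    summable over time, so the quantities tend to [0] almost surely.  On each
    such path all the states eventually lie close to one common integer; that
    integer cannot change any more, since a quantized value different from it
    would bring a state near a half integer.  The mean of the limit follows by
    dominated convergence from the conservation of [E S]. *)

From HB Require Import structures.
Require Import Defs.
From mathcomp Require Import all_boot all_order all_algebra.
From mathcomp Require Import all_classical all_reals all_analysis.
From mathcomp Require Import measurable_realfun ring lra zify.
Import Order.TTheory GRing.Theory Num.Theory.
Import numFieldNormedType.Exports.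
Local Open Scope classical_set_scope.
Local Open Scope ring_scope.

Set Implicit Arguments.
Unset Strict Implicit.
Unset Printing Implicit Defensive.

(** * Rounding *)

(** The variance of the random integer [q_p(x)], which is Bernoulli shifted by the floor of [x]. *)
Definition bernoulli_var (R : realType) (x : R) : R :=
  (x - (Num.floor x)%:~R) * (1 - (x - (Num.floor x)%:~R)).

Definition nearest (R : realType) (x : R) : int := Num.floor (x + 2^-1).

Section Rounding.
Context {R : realType}.
Implicit Types (x y : R) (k : int) (M : nat).

Lemma floor_bounds x : ((Num.floor x)%:~R <= x < (Num.floor x)%:~R + 1)%R.
Proof. by have := floor_itv x; rewrite intrD. Qed.

Lemma bernoulli_var_ge0 x : 0 <= bernoulli_var x.
Proof.
by rewrite /bernoulli_var mulr_ge0 ?subr_ge0; have /andP[] := floor_bounds x; lra.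
Qed.

Lemma bernoulli_var_le1 x : bernoulli_var x <= 1.
Proof. by rewrite /bernoulli_var; have /andP[] := floor_bounds x; nra. Qed.

(** With [f] the fractional part, the distance is the smaller of [f] and [1 - f], and the other
    factor of [bernoulli_var] is at least one half. *)
Lemma dist_nearest_le x : `|x - (nearest x)%:~R| <= 2 * bernoulli_var x.
Proof.
rewrite /nearest /bernoulli_var; have /andP[] := floor_bounds x.
move: (Num.floor x) => n n1 n2.
have [h|h] := ltP (x - n%:~R) 2^-1.
  rewrite (@floor_def _ _ n); last by rewrite intrD; apply/andP; split; lra.
  by rewrite ger0_norm; nra.
rewrite (@floor_def _ _ (n + 1)); last by rewrite !intrD; apply/andP; split; lra.
by rewrite intrD ler0_norm; nra.
Qed.

Lemma quantizer_prob_ge0 x k : 0 <= quantizer_prob x k.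
Proof.
rewrite /quantizer_prob; case: ifP => _; first by case: eqP.
case: ifP => _; first by rewrite subr_ge0 ceil_ge.
by case: ifP => // _; rewrite subr_ge0 floor_le.
Qed.

Lemma quantizer_prob_le1 x k : quantizer_prob x k <= 1.
Proof.
rewrite /quantizer_prob; case: ifP => [_|xZ]; first by case: eqP.
have /andP[h1 h2] := floor_bounds x.
rewrite ceil_floor xZ/= intrD.
by do 2?case: ifP => _; lra.
Qed.

Lemma quantizer_prob_neq0 x k : quantizer_prob x k != 0 ->
  (Num.floor x <= k <= Num.ceil x)%R.
Proof.
rewrite /quantizer_prob ceil_floor; case: ifP => [_|xZ].
  case: (k%:~R =P x) => [<- _|]; last by rewrite eqxx.
  by rewrite intrKfloor lexx lerDl.
case: ifP => [/eqP -> _|_]; first by rewrite lexx lerDl.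
by case: ifP => [/eqP -> _|_]; [rewrite xZ lexx lerDl|rewrite eqxx].
Qed.

(** A finite window for the quantized values of states bounded by [M], so that all moments become
    finite sums. *)
Definition int_range M : seq int := [seq (j%:Z - M%:Z)%R | j <- iota 0 (M + M).+1].

Lemma int_range_uniq M : uniq (int_range M).
Proof. by rewrite map_inj_uniq ?iota_uniq// => a b; lia. Qed.

Lemma mem_int_range M k : (- M%:Z <= k <= M%:Z)%R -> k \in int_range M.
Proof.
move=> kM; apply/mapP; exists `|(k + M%:Z)%R|%N; last lia.
by rewrite mem_iota; lia.
Qed.

(** The bound [M] is a natural number: an interval with integer endpoints is stable under
    rounding. *)
Lemma floor_ceil_bounded M x k : `|x| <= M%:R ->
  Num.floor x <= k <= Num.ceil x -> (- M%:Z <= k <= M%:Z)%R.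
Proof.
rewrite ler_norml => /andP[xM1 xM2] /andP[h1 h2].
apply/andP; split.
  by apply: le_trans h1; rewrite floor_ge_int mulrNz.
by apply: le_trans h2 _; rewrite ceil_le_int.
Qed.

(** Only the floor and the ceiling carry mass. Writing [Num.floor x + 1] for the ceiling covers
    integers too, because its weight is then zero. *)
Lemma sum_quantizer_prob M x (h : int -> R) : `|x| <= M%:R ->
  \sum_(k <- int_range M) h k * quantizer_prob x k =
  h (Num.floor x) * (1 - (x - (Num.floor x)%:~R)) +
  h (Num.floor x + 1) * (x - (Num.floor x)%:~R).
Proof.
move=> xM.
have fl : Num.floor x \in int_range M.
  by apply: mem_int_range; apply: (floor_ceil_bounded xM); rewrite lexx ceil_floor lerDl.
rewrite (bigD1_seq _ fl (int_range_uniq M))/=.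
have [xZ|xZ] := boolP (x \is a Num.int).
  rewrite big1 ?addr0 => [|k kx].
    by rewrite /quantizer_prob xZ floorK// eqxx subrr subr0 !mulr0 !addr0.
  rewrite /quantizer_prob xZ; case: eqP => [kE|_]; last by rewrite mulr0.
  by move: kx; rewrite -kE intrKfloor eqxx.
have ceE : Num.ceil x = Num.floor x + 1 by rewrite ceil_floor xZ.
have ce : Num.floor x + 1 \in int_range M.
  by apply: mem_int_range; apply: (floor_ceil_bounded xM); rewrite ceE; lia.
rewrite (big_rem _ ce) ifT; last by lia.
rewrite big_seq_cond big1 ?addr0 => [|k].
  rewrite /quantizer_prob (negbTE xZ) eqxx ceE eqxx ifF; last by lia.
  by rewrite intrD [X in _ + X]addr0; ring.
rewrite mem_rem_uniq ?int_range_uniq// !inE => /andP[/andP[k1 _] k2].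
by rewrite /quantizer_prob (negbTE xZ) (negbTE k2) ceE (negbTE k1) mulr0.
Qed.

Lemma quantizer_mean M x : `|x| <= M%:R ->
  \sum_(k <- int_range M) k%:~R * quantizer_prob x k = x.
Proof. by move=> xM; rewrite sum_quantizer_prob// intrD; ring. Qed.

Lemma quantizer_second_moment M x : `|x| <= M%:R ->
  \sum_(k <- int_range M) k%:~R ^+ 2 * quantizer_prob x k =
  x ^+ 2 + bernoulli_var x.
Proof. by move=> xM; rewrite sum_quantizer_prob// intrD /bernoulli_var; ring. Qed.

End Rounding.

(** * Deterministic convergence along a path *)

(** Minus the expected drift of [lyapunov] below when the edge joining two nodes
    with states [a] and [b] is selected. *)
Definition edge_energy (R : realType) (a b : R) : R :=
  2^-1 * (a - b) ^+ 2 + 4^-1 * (bernoulli_var a + bernoulli_var b).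

Lemma edge_energy_ge0 (R : realType) (a b : R) : 0 <= edge_energy a b.
Proof.
rewrite /edge_energy addr_ge0// mulr_ge0 ?sqr_ge0 ?addr_ge0 ?bernoulli_var_ge0//.
all: by rewrite invr_ge0.
Qed.

Lemma simple_graph_neq (V : finType) (E : {set {set V}}) (i j : V) :
  simple_graph E -> [set i; j]%SET \in E -> i != j.
Proof. by move=> hE /hE; rewrite cards2; case: (i != j). Qed.

Section Path.
Context {R : realType} {N : nat} (E : {set {set 'I_N}}).
Context (hE : simple_graph E) (hconn : connected_graph E).
Context (e0 : {set 'I_N}) (e0E : e0 \in E).

(** The energy controls a node only through an edge at it. Since [e0] has two endpoints, one differs
    from [i], and a path from [i] to it starts with such an edge. *)
Lemma incident_edge (i : 'I_N) : exists j, [set i; j]%SET \in E.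
Proof.
have /card_gt1P[a [b [_ _ ab]]] : (1 < #|e0|)%N by rewrite hE.
have [j ij] : exists j, i != j.
  by have [<-|ia] := eqVneq a i; [exists b; rewrite ab|exists a; rewrite eq_sym].
have /connectP[[|k p]/=] := hconn i j; first by move=> _ ji; rewrite ji eqxx in ij.
by move=> /andP[ik _] _; exists k.
Qed.

Lemma connected_const (U : Type) (f : 'I_N -> U) :
  (forall i j, [set i; j]%SET \in E -> f i = f j) -> forall i j, f i = f j.
Proof.
move=> fE i j; have /connectP[p] := hconn i j.
elim: p i => [|k p IH] i /=; first by move=> _ ->.
by move=> /andP[/fE -> /IH]; exact.
Qed.

Context (x q : nat -> 'I_N -> R) (sel : nat -> {set 'I_N}).
Hypothesis selE : forall t, sel t \in E.
Hypothesis q_int : forall t i, q t i \is a Num.int.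
Hypothesis q_near : forall t i, `|q t i - x t i| < 1.
(** A single sample path is seen as a process on the one-point space [unit]. *)
Hypothesis gossip : partially_quantized_gossip
  (fun t i (_ : unit) => x t i) (fun t i _ => q t i) (fun t _ => sel t).
Hypothesis energy_cvg0 : forall i j, [set i; j]%SET \in E ->
  edge_energy (x t i) (x t j) @[t --> \oo] --> 0.

Lemma near_energy_lt (eps : R) : 0 < eps ->
  \forall t \near \oo, forall i j, [set i; j]%SET \in E ->
    edge_energy (x t i) (x t j) < eps.
Proof.
move=> e0'; apply: filter_forall => i; apply: filter_forall => j.
have [ijE|ijE] := boolP ([set i; j]%SET \in E); last by near=> t.
have /cvgrPdist_lt /(_ _ e0') := energy_cvg0 ijE.
apply: filterS => t; rewrite sub0r normrN => h _.
by apply: le_lt_trans h; rewrite ler_norm.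
Unshelve. all: by end_near.
Qed.

Lemma dist_nearest_energy (a b : R) :
  `|a - (nearest a)%:~R| <= 8 * edge_energy a b.
Proof.
apply: le_trans (dist_nearest_le a) _; rewrite /edge_energy.
have := bernoulli_var_ge0 b; have := sqr_ge0 (a - b); lra.
Qed.

Lemma gossip_path_cvg :
  exists k : int, forall i, x t i @[t --> \oo] --> (k%:~R : R).
Proof.
(* Energy below 1/128 puts each state within 8/128 = 1/16 of an integer and, through the term
   [2^-1 * (a - b) ^+ 2], adjacent states within 1/8 of each other. Neighbouring nearest integers
   then differ by less than 1. *)
have e128 : (0 : R) < 128^-1 by rewrite invr_gt0.
have [T0 _ small] := near_energy_lt e128.
have r_near t i : (T0 <= t)%N -> `|x t i - (nearest (x t i))%:~R| < 16^-1.
  move=> tT; have [j ijE] := incident_edge i.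
  have := dist_nearest_energy (x t i) (x t j).
  by have := small t tT i j ijE; lra.
have r_const t i j : (T0 <= t)%N -> nearest (x t i) = nearest (x t j).
  move=> tT; apply: (connected_const (f := fun i => nearest (x t i))) => {}i {}j ijE.
  have := r_near t i tT; have := r_near t j tT.
  rewrite !ltr_norml => /andP[j1 j2] /andP[i1 i2].
  have := small t tT i j ijE; rewrite /edge_energy => D.
  have vi := bernoulli_var_ge0 (x t i); have vj := bernoulli_var_ge0 (x t j).
  have : `|x t i - x t j| < 8^-1.
    rewrite -(@ltr_pXn2r _ 2) ?nnegrE ?invr_ge0// real_normK ?num_real//; lra.
  rewrite ltr_norml => /andP[d1 d2].
  apply/eqP; rewrite eq_le -!ltzD1 -!(ltr_int R) !intrD.
  by apply/andP; split; lra.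
have [i0 [j0 [i0j0 e0ij]]] : exists i j : 'I_N, i != j /\ e0 = [set i; j]%SET.
  by have /eqP/cards2P[a [b [ab ->]]] := hE e0E; exists a, b.
pose r t := nearest (x t i0).
have rE t i : (T0 <= t)%N -> nearest (x t i) = r t by move=> tT; exact: r_const.
have r_step t : (T0 <= t)%N -> r t.+1 = r t.
  (* The nearest integer is common to all nodes, so the step can be checked at an endpoint of the
     selected edge instead of [i0]. *)
  move=> tT; have /eqP/cards2P[i [j [ij selt]]] := hE (selE t).
  have [/(_ i j ij selt)[xi _] _] := gossip t tt.
  have := r_near t.+1 i (leqW tT); have := r_near t i tT; have := r_near t j tT.
  rewrite !rE ?(leqW tT)// xi; have := q_near t j.
  have /intrP[k ->] := q_int t j.
  rewrite !ltr_norml => /andP[q1 q2] /andP[j1 j2] /andP[i1 i2] /andP[s1 s2].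
  have k1 : (r t - 2 < k)%R by rewrite -(ltr_int R) intrB; lra.
  have k2 : (k < r t + 2)%R by rewrite -(ltr_int R) intrD; lra.
  have k3 : (r t + k - 1 < r t.+1 + r t.+1)%R.
    by rewrite -(ltr_int R) intrB !intrD; lra.
  have k4 : (r t.+1 + r t.+1 < r t + k + 1)%R.
    by rewrite -(ltr_int R) !intrD; lra.
  (* [2 r(t+1) = r t + k] with [|k - r t| <= 1] forces [k = r t]. *)
  lia.
have r_eq t : (T0 <= t)%N -> r t = r T0.
  elim: t => [|t IH]; first by rewrite leqn0 => /eqP ->.
  by rewrite leq_eqVlt => /predU1P[->//|tT]; rewrite r_step// IH.
exists (r T0) => i; apply/cvgrPdist_lt => eps eps0.
have e8 : 0 < eps / 8 by rewrite divr_gt0.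
have [T1 _ small1] := near_energy_lt e8.
exists (maxn T0 T1) => // t /=; rewrite geq_max => /andP[tT0 tT1].
have [j ijE] := incident_edge i.
rewrite distrC -(r_eq t tT0) -(rE t i tT0).
have := dist_nearest_energy (x t i) (x t j).
by have := small1 t tT1 i j ijE; lra.
Qed.

End Path.

(** * Finite-valued random variables *)

Section Expectation.
Context {d : measure_display} {T : measurableType d} {R : realType}.
Context (P : probability T R).
Implicit Types (f g : T -> R) (A B : set T) (F : set (set T)).

Local Notation Ex f := (Rintegral P setT f).

(** The bound is almost sure because the states are controlled only on the paths where every
    quantized value is a legitimate rounding. *)
Definition bounded_rv f :=
  measurable_fun setT f /\ exists C : R, \forall w \ae P, `|f w| <= C.

Lemma bounded_rv_integrable f : bounded_rv f -> P.-integrable setT (EFin \o f).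
Proof.
move=> [mf [C fC]]; apply/integrableP; split; first exact/measurable_EFinP.
apply: (@le_lt_trans _ _ (\int[P]_w (cst `|C|%:E) w)%E).
  apply: ae_ge0_le_integral => //.
  - by apply: measurableT_comp => //; exact/measurable_EFinP.
  - by move=> w _; rewrite /= lee_fin.
  - by move: fC; apply: filterS => w fC _; rewrite /= lee_fin (le_trans fC)// ler_norm.
by rewrite integral_cst//= probability_setT mule1 ltry.
Qed.

Lemma bounded_rv_cst (c : R) : bounded_rv (fun=> c).
Proof. by split => //; exists `|c|; exact: aeW. Qed.

Lemma bounded_rvD f g : bounded_rv f -> bounded_rv g -> bounded_rv (fun w => f w + g w).
Proof.
move=> [mf [C fC]] [mg [D gD]]; split; first exact: measurable_funD.
exists (C + D); near=> w.
by rewrite (le_trans (ler_normD _ _))// lerD//; near: w.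
Unshelve. all: by end_near.
Qed.

Lemma bounded_rvM f g : bounded_rv f -> bounded_rv g -> bounded_rv (fun w => f w * g w).
Proof.
move=> [mf [C fC]] [mg [D gD]]; split; first exact: measurable_funM.
exists (C * D); near=> w.
by rewrite normrM ler_pM//; near: w.
Unshelve. all: by end_near.
Qed.

Lemma bounded_rvB f g : bounded_rv f -> bounded_rv g -> bounded_rv (fun w => f w - g w).
Proof.
move=> bf bg; rewrite (_ : (fun _ => _) = (fun w => f w + -1 * g w)).
  by apply: bounded_rvD => //; apply: bounded_rvM => //; exact: bounded_rv_cst.
by apply/funext => w; rewrite mulN1r.
Qed.

Lemma bounded_rvX2 f : bounded_rv f -> bounded_rv (fun w => f w ^+ 2).
Proof. by move=> bf; rewrite (_ : (fun _ => _) = (fun w => f w * f w)); [exact: bounded_rvM|]. Qed.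

Lemma bounded_rv_sum (I : Type) (s : seq I) (p : pred I) (f : I -> T -> R) :
  (forall i, bounded_rv (f i)) -> bounded_rv (fun w => \sum_(i <- s | p i) f i w).
Proof.
move=> bf; elim: s => [|i s IH].
  by under eq_fun do rewrite big_nil; exact: bounded_rv_cst.
under eq_fun do rewrite big_cons; case: (p i) => //.
exact: bounded_rvD.
Qed.

Lemma bounded_rv_indic A : measurable A -> bounded_rv (\1_A : T -> R).
Proof.
move=> mA; split; first exact: measurable_indic.
by exists 1; apply: aeW => w; rewrite indicE; case: (w \in A); rewrite ?normr1 ?normr0.
Qed.

Lemma Ex_cst (c : R) : Ex (fun=> c) = c.
Proof. by rewrite Rintegral_cst//= probability_setT mulr1. Qed.

Lemma ExD f g : bounded_rv f -> bounded_rv g ->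
  Ex (fun w => f w + g w) = Ex f + Ex g.
Proof. by move=> bf bg; rewrite RintegralD//; exact: bounded_rv_integrable. Qed.

Lemma ExB f g : bounded_rv f -> bounded_rv g ->
  Ex (fun w => f w - g w) = Ex f - Ex g.
Proof. by move=> bf bg; rewrite RintegralB//; exact: bounded_rv_integrable. Qed.

Lemma ExZ (c : R) f : bounded_rv f -> Ex (fun w => c * f w) = c * Ex f.
Proof. by move=> bf; rewrite RintegralZl//; exact: bounded_rv_integrable. Qed.

Lemma Ex_sum (I : Type) (s : seq I) (p : pred I) (f : I -> T -> R) :
  (forall i, bounded_rv (f i)) ->
  Ex (fun w => \sum_(i <- s | p i) f i w) = \sum_(i <- s | p i) Ex (f i).
Proof.
move=> bf; elim: s => [|i s IH].
  by under eq_Rintegral do rewrite big_nil; rewrite Ex_cst big_nil.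
under eq_Rintegral do rewrite big_cons; rewrite big_cons; case: (p i) => //.
by rewrite ExD ?IH//; exact: bounded_rv_sum.
Qed.

Lemma Ex_ae f g : measurable_fun setT f -> measurable_fun setT g ->
  (\forall w \ae P, f w = g w) -> Ex f = Ex g.
Proof.
move=> mf mg fg; congr fine; apply: ae_eq_integral => //.
- exact/measurable_EFinP.
- exact/measurable_EFinP.
- by move: fg; apply: filterS => w + _ => ->.
Qed.

Lemma Ex_norm_le f (C : R) : measurable_fun setT f ->
  (\forall w \ae P, `|f w| <= C) -> `|Ex f| <= C.
Proof.
move=> mf fC.
have bf : bounded_rv f by split => //; exists C.
apply: le_trans (le_normr_Rintegral measurableT (bounded_rv_integrable bf)) _.
rewrite -(Ex_cst C) -subr_ge0 -ExB; last 2 first.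
- exact: bounded_rv_cst.
- split; first exact: measurableT_comp.
  by exists C; move: fC; apply: filterS => w; rewrite normr_id.
(* The difference is nonnegative only almost surely; its absolute value is so everywhere. *)
rewrite (@Ex_ae _ (fun w => `|C - `|f w| |)); last 1 first.
- by move: fC; apply: filterS => w fC; rewrite [RHS]ger0_norm ?subr_ge0.
- exact: Rintegral_ge0.
- by apply: measurable_funB => //; exact: measurableT_comp.
- by apply: measurableT_comp => //; apply: measurable_funB => //; exact: measurableT_comp.
Qed.

Lemma Ex_indic A : measurable A -> Ex \1_A = fine (P A).
Proof. by move=> mA; rewrite /Rintegral integral_indic// setIT. Qed.

Lemma Ex_indicM A f : Ex (fun w => \1_A w * f w) = fine (\int[P]_(w in A) (f w)%:E)%E.
Proof.
transitivity (Rintegral P A f) => //; rewrite [RHS]Rintegral_mkcond.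
by apply: eq_Rintegral => w _; rewrite patchE indicE; case: (w \in A); rewrite ?mul1r ?mul0r.
Qed.

(** Combinations of indicators of sets of [F], built one term at a time: identities known on sets of
    [F] extend to them by induction, without a general theory of conditional expectation. *)
Inductive simple_comb F : (T -> R) -> Prop :=
| simple_comb0 : simple_comb F (fun=> 0)
| simple_combS c A f : F A -> simple_comb F f ->
    simple_comb F (fun w => c * \1_A w + f w).

(** Measurability is with respect to the ambient sigma-algebra; [F] enters only through an almost
    sure representative. *)
Definition simple_rv F f := measurable_fun setT f /\
  exists2 g, simple_comb F g & \forall w \ae P, f w = g w.

Lemma simple_comb_bounded F f : F `<=` measurable -> simple_comb F f -> bounded_rv f.
Proof.
move=> Fm; elim => [|c A {}f FA _ IH]; first exact: bounded_rv_cst.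
apply: bounded_rvD => //; apply: bounded_rvM; first exact: bounded_rv_cst.
exact/bounded_rv_indic/Fm.
Qed.

Lemma simple_rv_bounded F f : F `<=` measurable -> simple_rv F f -> bounded_rv f.
Proof.
move=> Fm [mf [g /(simple_comb_bounded Fm)[_ [C gC]] fg]]; split => //.
by exists C; near=> w; rewrite (_ : f w = g w); near: w.
Unshelve. all: by end_near.
Qed.

Lemma simple_combD F f g : simple_comb F f -> simple_comb F g ->
  simple_comb F (fun w => f w + g w).
Proof.
move=> + cg; elim => [|c A {}f FA _ IH].
  by under eq_fun do rewrite add0r.
by under eq_fun do rewrite -addrA; constructor.
Qed.

Lemma simple_combZ F c f : simple_comb F f -> simple_comb F (fun w => c * f w).
Proof.
elim => [|k A {}f FA _ IH]; first by under eq_fun do rewrite mulr0; constructor.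
by under eq_fun do rewrite mulrDr mulrA; constructor.
Qed.

Lemma simple_combM F f g : setI_closed F -> simple_comb F f -> simple_comb F g ->
  simple_comb F (fun w => f w * g w).
Proof.
move=> FI + cg; elim => [|c A {}f FA _ IH].
  by under eq_fun do rewrite mul0r; constructor.
under eq_fun do rewrite mulrDl -mulrA.
apply: simple_combD => //; apply: simple_combZ.
elim: cg {IH} => [|k B {}g FB _ IHg]; first by under eq_fun do rewrite mulr0; constructor.
rewrite (_ : (fun _ => _) = (fun w => k * \1_(A `&` B) w + \1_A w * g w)).
  by constructor => //; exact: FI.
by apply/funext => w; rewrite indicI/=; ring.
Qed.

Lemma simple_rv_ae F f g : measurable_fun setT f ->
  (\forall w \ae P, f w = g w) -> simple_rv F g -> simple_rv F f.
Proof.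
move=> mf fg [_ [h ch gh]]; split => //; exists h => //.
by move: fg gh; apply: filterS2 => w -> ->.
Qed.

Lemma simple_rvD F f g : simple_rv F f -> simple_rv F g ->
  simple_rv F (fun w => f w + g w).
Proof.
move=> [mf [f' cf ff']] [mg [g' cg gg']]; split; first exact: measurable_funD.
exists (fun w => f' w + g' w); first exact: simple_combD.
by move: ff' gg'; apply: filterS2 => w -> ->.
Qed.

Lemma simple_rvM F f g : setI_closed F -> simple_rv F f -> simple_rv F g ->
  simple_rv F (fun w => f w * g w).
Proof.
move=> FI [mf [f' cf ff']] [mg [g' cg gg']]; split; first exact: measurable_funM.
exists (fun w => f' w * g' w); first exact: simple_combM.
by move: ff' gg'; apply: filterS2 => w -> ->.
Qed.

Lemma simple_rv_cst F (c : R) : F setT -> simple_rv F (fun=> c).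
Proof.
move=> FT; split => //; exists (fun w => c * \1_setT w + 0).
  by constructor => //; constructor.
by apply: aeW => w; rewrite indicT mulr1 addr0.
Qed.

Lemma simple_rvB F f g : F setT -> setI_closed F -> simple_rv F f -> simple_rv F g ->
  simple_rv F (fun w => f w - g w).
Proof.
move=> FT FI sf sg; rewrite (_ : (fun _ => _) = (fun w => f w + -1 * g w)).
  by apply: simple_rvD => //; apply: simple_rvM => //; exact: simple_rv_cst.
by apply/funext => w; rewrite mulN1r.
Qed.

Lemma simple_rvX2 F f : setI_closed F -> simple_rv F f -> simple_rv F (fun w => f w ^+ 2).
Proof. by move=> FI sf; rewrite (_ : (fun _ => _) = (fun w => f w * f w)); [exact: simple_rvM|]. Qed.

Lemma simple_rv_indic F A : measurable A -> F A -> simple_rv F \1_A.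
Proof.
move=> mA FA; split; first exact: measurable_indic.
exists (fun w => 1 * \1_A w + 0); first by constructor => //; constructor.
by apply: aeW => w; rewrite mul1r addr0.
Qed.

Lemma simple_rv_sum F (I : Type) (s : seq I) (p : pred I) (f : I -> T -> R) :
  F setT -> (forall i, simple_rv F (f i)) ->
  simple_rv F (fun w => \sum_(i <- s | p i) f i w).
Proof.
move=> FT sf; elim: s => [|i s IH].
  by under eq_fun do rewrite big_nil; exact: simple_rv_cst.
under eq_fun do rewrite big_cons; case: (p i) => //.
exact: simple_rvD.
Qed.

(** The pull-out property of conditional probability, by linearity from sets of [F]. It serves both
    for quantized values, with [g] the quantizer law, and for edge selection, with [g] a
    constant. *)
Lemma Ex_simple_cond F B g f : F `<=` measurable -> measurable B -> bounded_rv g ->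
  (forall A, F A -> (\int[P]_(w in A) (g w)%:E = P (A `&` B))%E) ->
  simple_rv F f ->
  Ex (fun w => f w * \1_B w) = Ex (fun w => f w * g w).
Proof.
move=> Fm mB bg gB [mf [h ch fh]].
have bB := bounded_rv_indic mB; have bh := simple_comb_bounded Fm ch.
have eqE k : bounded_rv k -> Ex (fun w => f w * k w) = Ex (fun w => h w * k w).
  move=> [mk _]; apply: Ex_ae; [exact: measurable_funM|exact: measurable_funM bh.1 mk|].
  by move: fh; apply: filterS => w ->.
rewrite !eqE// {eqE f mf fh bh}; elim: ch => [|c A f FA cf IH].
  by under eq_Rintegral do rewrite mul0r; under [RHS]eq_Rintegral do rewrite mul0r.
have bf := simple_comb_bounded Fm cf; have bA := bounded_rv_indic (Fm _ FA).
have step k : bounded_rv k -> Ex (fun w => (c * \1_A w + f w) * k w) =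
    c * Ex (fun w => \1_A w * k w) + Ex (fun w => f w * k w).
  move=> bk; under eq_Rintegral do rewrite mulrDl -mulrA.
  rewrite ExD ?ExZ//; first exact: bounded_rvM.
  - by apply: bounded_rvM; [exact: bounded_rv_cst|exact: bounded_rvM].
  - exact: bounded_rvM.
rewrite !step// IH; congr (_ * _ + _).
rewrite !Ex_indicM gB// -Ex_indicM -Ex_indic; last by apply: measurableI => //; exact: Fm.
by apply: eq_Rintegral => w _; rewrite !indicE in_setI -mulnb natrM.
Qed.

End Expectation.

(** * Measurability, summable expectations and the observed sigma-algebras *)

Lemma measurable_floor (R : realType) :
  measurable_fun setT (fun a : R => (Num.floor a)%:~R : R).
Proof. by apply: nondecreasing_measurable => // a b ab; rewrite ler_int le_floor. Qed.

Lemma measurable_bernoulli_var (R : realType) :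
  measurable_fun setT (@bernoulli_var R).
Proof.
have mf := @measurable_floor R.
by apply: measurable_funM; repeat apply: measurable_funB.
Qed.

Section ObservedAlgebra.
Context {d : measure_display} {T : measurableType d} {R : realType}.
Context (P : probability T R).

(** By monotone convergence the sum of all [f t] has finite expectation, hence is finite almost
    surely, and the terms of a convergent series tend to 0. *)
Lemma summable_Ex_cvg0 (f : nat -> T -> R) (C : R) :
  (forall t, bounded_rv P (f t)) -> (forall t w, 0 <= f t w) ->
  (forall n, \sum_(t < n) Rintegral P setT (f t) <= C) ->
  \forall w \ae P, f t w @[t --> \oo] --> 0.
Proof.
move=> bf f0 fC.
have mf t : measurable_fun setT (EFin \o f t) by apply/measurable_EFinP; case: (bf t).
pose F w := (\sum_(0 <= t <oo) (f t w)%:E)%E.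
have F0 w : (0 <= F w)%E by apply: nneseries_ge0 => t _ _; rewrite lee_fin.
have iF : P.-integrable setT F.
  apply/integrableP; split.
    apply: ge0_emeasurable_sum => [t w _ _|t _]; last exact: mf.
    by rewrite lee_fin.
  under eq_integral do rewrite gee0_abs//.
  rewrite integral_nneseries//; last by move=> t w _; rewrite lee_fin.
  apply: (@le_lt_trans _ _ C%:E); last exact: ltry.
  apply: lime_le.
    by apply: is_cvg_nneseries => t _ _; apply: integral_ge0 => w _; rewrite lee_fin.
  apply: nearW => n; rewrite (_ : \sum_(0 <= t < n) _ = (\sum_(t < n) Rintegral P setT (f t))%:E)%E.
    by rewrite lee_fin.
  rewrite -sumEFin big_mkord; apply: eq_bigr => t _.
  by rewrite fineK//; apply: integrable_fin_num => //; exact: bounded_rv_integrable.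
have := integrable_ae measurableT iF; apply: filterS => w /(_ Logic.I) Fw.
apply: cvg_series_cvg_0; apply: nnseries_is_cvg => //.
by rewrite -ge0_fin_numE// F0.
Qed.

Lemma generated_setI_closed (G : set (set T)) : setI_closed <<s G >>.
Proof. by have [] := (sigma_algebraP (fun X _ => @subsetT _ X)).1 (smallest_sigma_algebra setT G). Qed.

Lemma generated_setT (G : set (set T)) : <<s G >> setT.
Proof. by have := sigma_algebraCD (@sigma_algebra0 _ setT G); rewrite setD0. Qed.

Context (N : nat) (x q : nat -> 'I_N -> {RV P >-> R}) (sel : nat -> T -> {set 'I_N}).

Lemma observed_measurable nx nq ns : (forall t e, measurable (sel t @^-1` [set e])) ->
  observed x q sel nx nq ns `<=` measurable.
Proof.
move=> msel; apply: smallest_sub; first exact: sigma_algebra_measurable.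
move=> A [[s [i [U [_ mU ->]]]]|[[s [i [U [_ mU ->]]]]|[s [e [_ ->]]]]] //.
- by rewrite -[X in measurable X]setTI; exact: measurable_funP.
- by rewrite -[X in measurable X]setTI; exact: measurable_funP.
Qed.

Lemma observed_q nx nq ns s i U : (s < nq)%N -> measurable U ->
  observed x q sel nx nq ns (q s i @^-1` U).
Proof. by move=> sq mU; apply: sub_sigma_algebra; right; left; exists s, i, U. Qed.

Lemma observed_sel nx nq ns s e : (s < ns)%N ->
  observed x q sel nx nq ns (sel s @^-1` [set e]).
Proof. by move=> sn; apply: sub_sigma_algebra; right; right; exists s, e. Qed.

End ObservedAlgebra.

(** * The gossip process *)

Section Gossip.
Context {d : measure_display} {T : measurableType d} {R : realType}.
Context (P : probability T R) (N : nat).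
Context (E : {set {set 'I_N}}) (W : {set 'I_N} -> R).
Context (x0 : 'I_N -> R) (x q : nat -> 'I_N -> {RV P >-> R}).
Context (sel : nat -> T -> {set 'I_N}).
Hypothesis hE : simple_graph E.
Hypothesis hsel : random_edge_selection E W x q sel.
Hypothesis hq : probabilistic_quantization x q sel.
Hypothesis hx0 : forall i w, x 0%N i w = x0 i.
Hypothesis hx : partially_quantized_gossip (fun t i w => x t i w)
  (fun t i w => q t i w) sel.
Context (M : nat).
Hypothesis hM : forall i, `|x0 i| <= M%:R.

Local Notation Ex f := (Rintegral P setT f).
Local Notation obs := (observed x q sel).

Let selE t w : sel t w \in E. Proof. by case: hsel. Qed.
Let msel t e : measurable (sel t @^-1` [set e]). Proof. by case: hsel. Qed.
Let q_int t i w : q t i w \is a Num.int. Proof. by case: hq. Qed.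
Let obs_m nx nq ns : obs nx nq ns `<=` measurable.
Proof. exact: observed_measurable. Qed.
Let mq t i (k : int) : measurable (q t i @^-1` [set k%:~R]).
Proof. by rewrite -[X in measurable X]setTI; exact: measurable_funP. Qed.

Definition admissible w := forall t i (k : int), q t i w = k%:~R ->
  Num.floor (x t i w) <= k <= Num.ceil (x t i w).

(** The event that [quantizer_prob] vanishes at [k] is observed, so its intersection with
    [q t i = k] has as probability the integral of 0. Countably many such null sets are
    discarded. *)
Lemma admissible_ae : \forall w \ae P, admissible w.
Proof.
have [_ hq2 _] := hq.
apply: ae_foralln => t; apply: filter_forall => i.
suff H (k : int) : \forall w \ae P, q t i w = k%:~R ->
    Num.floor (x t i w) <= k <= Num.ceil (x t i w).
  (* The integers [k] are enumerated by [unpickle] to quantify over them inside the almost sure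
     statement. *)
  have : \forall w \ae P, forall n, if unpickle n is Some k then
      q t i w = k%:~R -> Num.floor (x t i w) <= k <= Num.ceil (x t i w) else True.
    by apply: ae_foralln => n; case: (unpickle n) => [k|]; [exact: H|exact: aeW].
  by apply: filterS => w h k; have := h (pickle k); rewrite pickleK.
have [mg gB] := hq2 t i k.
have FA := mg _ (measurable_set1 (0 : R)).
exists ((fun w => quantizer_prob (x t i w) k) @^-1` [set 0] `&`
    q t i @^-1` [set k%:~R]); split.
- by apply: measurableI => //; exact: obs_m FA.
- by rewrite -gB// integral0_eq// => w /= ->.
- move=> w /= /not_implyP[qk nk]; split => //; apply: contrapT => /eqP.
  by move=> /quantizer_prob_neq0.
Qed.

(** This form shows the new state as a polynomial in old states, quantized values and selection
    indicators, from which [x_simple] follows by induction. *)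
Lemma x_step t i w : x t.+1 i w = x t i w +
  \sum_(j | j != i) \1_(sel t @^-1` [set [set i; j]%SET]) w *
    (2^-1 * (q t j w - x t i w)).
Proof.
have [h1 h2] := hx t w.
have [isel|isel] := boolP (i \in sel t w); last first.
  rewrite (h2 _ isel) big1 ?addr0// => j ji.
  rewrite indicE memNset ?mul0r//= => seq; move: isel.
  by rewrite seq set21.
have [j ji selt] : exists2 j, j != i & sel t w = [set i; j]%SET.
  have /eqP/cards2P[a [b [ab selt]]] := hE (selE t w).
  move: isel; rewrite selt !inE => /orP[/eqP ->|/eqP ->].
    by exists b => //; rewrite eq_sym.
  by exists a => //; rewrite finset.setUC.
rewrite (bigD1 j)//= big1 => [|k /andP[ki kj]].
  rewrite indicE mem_set// mul1r addr0.
  by have [||-> _] := h1 i j => //; [rewrite eq_sym|lra].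
rewrite indicE memNset ?mul0r//= selt => /setP /(_ k).
by rewrite !inE (negbTE ki) (negbTE kj) eqxx.
Qed.

Lemma x_bounded w : admissible w -> forall t i, `|x t i w| <= M%:R.
Proof.
move=> aw; elim => [i|t IH i]; first by rewrite hx0.
have qM j : `|q t j w| <= M%:R.
  have /intrP[k qk] := q_int t j w.
  have /andP[k1 k2] := floor_ceil_bounded (IH j) (aw t j k qk).
  by rewrite qk ler_norml -!(ler_int R) mulrNz in k1 k2 *; rewrite k1 k2.
have [h1 h2] := hx t w.
have [isel|/h2 -> //] := boolP (i \in sel t w).
have /eqP/cards2P[a [b [ab selt]]] := hE (selE t w).
have [xa xb] := h1 a b ab selt.
have := (IH a, IH b, qM a, qM b); rewrite !ler_norml => -[[[Ia Ib] Qa] Qb].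
by move: isel; rewrite selt !inE => /orP[/eqP ->|/eqP ->]; rewrite ?xa ?xb; lra.
Qed.

(** On an admissible path the value of [q t i] lies in [int_range M], so exactly one indicator is
    1. *)
Lemma quantized_decomp w (H : R -> R) t i : admissible w ->
  H (q t i w) = \sum_(k <- int_range M)
    H k%:~R * \1_(q t i @^-1` [set k%:~R]) w.
Proof.
move=> aw; have /intrP[k qk] := q_int t i w.
have kM : k \in int_range M.
  exact/mem_int_range/(floor_ceil_bounded (x_bounded aw t i))/(aw t i k qk).
rewrite (bigD1_seq _ kM (int_range_uniq M))/= big1 => [|l lk].
  by rewrite indicE mem_set//= qk mulr1 addr0.
rewrite indicE memNset ?mulr0//= qk => /eqP; rewrite eqr_int eq_sym.
by rewrite (negbTE lk).
Qed.

Lemma q_simple nx nq ns t i : (t < nq)%N -> simple_rv P (obs nx nq ns) (q t i).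
Proof.
move=> tq; pose g w := \sum_(k <- int_range M) k%:~R * \1_(q t i @^-1` [set k%:~R]) w : R.
apply: (@simple_rv_ae _ _ _ _ _ _ g) => //.
  by move: admissible_ae; apply: filterS => w aw; exact: (quantized_decomp id).
apply: simple_rv_sum => [|k]; first exact: generated_setT.
apply: simple_rvM; [exact: generated_setI_closed|apply: simple_rv_cst; exact: generated_setT|].
by apply: simple_rv_indic => //; exact: observed_q.
Qed.

(** The start is deterministic, so quantized values and selections before time [t] determine [x t];
    hence the conditions on [nq] and [ns]. *)
Lemma x_simple nx nq ns t i : (t <= nq)%N -> (t <= ns)%N ->
  simple_rv P (obs nx nq ns) (x t i).
Proof.
have FT : obs nx nq ns setT by exact: generated_setT.
have FI : setI_closed (obs nx nq ns) by exact: generated_setI_closed.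
elim: t i => [i _ _|t IH i tq ts].
  by rewrite (_ : (x 0%N i : T -> R) = fun=> x0 i); [exact: simple_rv_cst|by apply/funext => w; exact: hx0].
rewrite (_ : (x t.+1 i : T -> R) = fun w => x t i w +
    \sum_(j | j != i) \1_(sel t @^-1` [set [set i; j]%SET]) w *
    (2^-1 * (q t j w - x t i w))); last by apply/funext => w; exact: x_step.
have sx := IH i (ltnW tq) (ltnW ts).
apply: simple_rvD => //; apply: simple_rv_sum => // j.
apply: simple_rvM => //; first by apply: simple_rv_indic => //; exact: observed_sel.
apply: simple_rvM => //; first exact: simple_rv_cst.
by apply: simple_rvB => //; exact: q_simple.
Qed.

Lemma x_bounded_rv t i : bounded_rv P (x t i).
Proof. exact: simple_rv_bounded (@obs_m 0 t t) (x_simple _ _ (leqnn t) (leqnn t)). Qed.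

Lemma q_bounded_rv t i : bounded_rv P (q t i).
Proof. exact: simple_rv_bounded (@obs_m 0 t.+1 t) (q_simple _ _ _ (ltnSn t)). Qed.

Let quantizer_bounded t i k : bounded_rv P (fun w => quantizer_prob (x t i w) k).
Proof.
have [_ /(_ t i k)[mg _] _] := hq; split.
  by move=> _ U mU; rewrite setTI; exact: obs_m (mg U mU).
exists 1; apply: aeW => w; rewrite ger0_norm ?quantizer_prob_ge0//.
exact: quantizer_prob_le1.
Qed.

Let bernoulli_bounded t i : bounded_rv P (fun w => bernoulli_var (x t i w)).
Proof.
split; first by apply: measurableT_comp => //; exact: measurable_bernoulli_var.
exists 1; apply: aeW => w; rewrite ger0_norm ?bernoulli_var_ge0//.
exact: bernoulli_var_le1.
Qed.

Let q_indic_bounded t i (k : int) : bounded_rv P \1_(q t i @^-1` [set k%:~R : R]).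
Proof. exact: bounded_rv_indic. Qed.

Ltac bounded := repeat first
  [ exact: x_bounded_rv | exact: q_bounded_rv | exact: bounded_rv_cst
  | exact: quantizer_bounded | exact: bernoulli_bounded | exact: q_indic_bounded
  | assumption
  | apply: bounded_rvB | apply: bounded_rvD | apply: bounded_rvX2
  | apply: bounded_rvM | apply: bounded_rv_sum => ? ].

(** * Moments of the quantization noise *)

(** The tower property: [Z] is known once [x t] and the past are, so [H (q t i)] may be replaced by
    its conditional mean, level set by level set. *)
Lemma Ex_quantized t i (H : R -> R) (Z : T -> R) :
  measurable_fun setT H -> simple_rv P (obs t.+1 t t) Z ->
  Ex (fun w => Z w * H (q t i w)) =
  Ex (fun w => Z w * \sum_(k <- int_range M) H k%:~R * quantizer_prob (x t i w) k).
Proof.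
move=> mH sZ; have bZ := simple_rv_bounded (@obs_m _ _ _) sZ.
rewrite (@Ex_ae _ _ _ _ _ (fun w => \sum_(k <- int_range M)
    H k%:~R * (Z w * \1_(q t i @^-1` [set k%:~R]) w))); last 3 first.
- by apply: measurable_funM; [case: bZ|exact: measurableT_comp].
- by apply: (proj1 (_ : bounded_rv P _)); bounded.
- move: admissible_ae; apply: filterS => w aw; rewrite (quantized_decomp H t i aw).
  by rewrite mulr_sumr; apply: eq_bigr => k _; rewrite mulrCA.
rewrite Ex_sum; last by move=> k; bounded.
transitivity (Ex (fun w => \sum_(k <- int_range M)
    H k%:~R * (Z w * quantizer_prob (x t i w) k))).
  rewrite Ex_sum; last by move=> k; bounded.
  apply: eq_bigr => k _; rewrite !ExZ; [|bounded..].
  have [_ /(_ t i k)[_ gB] _] := hq.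
  by rewrite (Ex_simple_cond (@obs_m _ _ _) (mq t i k) (quantizer_bounded t i k) gB sZ).
by apply: eq_Rintegral => w _; rewrite mulr_sumr; apply: eq_bigr => k _; rewrite mulrCA.
Qed.

Lemma Ex_noise t i (Z : T -> R) : simple_rv P (obs t.+1 t t) Z ->
  Ex (fun w => Z w * (q t i w - x t i w)) = 0.
Proof.
move=> sZ; have bZ := simple_rv_bounded (@obs_m _ _ _) sZ.
under eq_Rintegral do rewrite mulrBr.
rewrite ExB; [|bounded..].
rewrite (Ex_quantized i (H := id))//; apply/eqP; rewrite subr_eq0; apply/eqP.
apply: Ex_ae; [by apply: (proj1 (_ : bounded_rv P _)); bounded..|].
move: admissible_ae; apply: filterS => w aw.
by rewrite quantizer_mean// x_bounded.
Qed.

Lemma Ex_noise2 t i :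
  Ex (fun w => (q t i w - x t i w) ^+ 2) = Ex (fun w => bernoulli_var (x t i w)).
Proof.
have FT : obs t.+1 t t setT by exact: generated_setT.
have e0 := Ex_noise i (x_simple t.+1 i (leqnn t) (leqnn t)).
have e1 : Ex (fun w => q t i w ^+ 2) =
    Ex (fun w => x t i w ^+ 2 + bernoulli_var (x t i w)).
  transitivity (Ex (fun w => 1 * q t i w ^+ 2)).
    by apply: eq_Rintegral => w _; rewrite mul1r.
  rewrite (Ex_quantized i (H := fun a => a ^+ 2)); last 2 first.
  - exact: exprn_measurable.
  - exact: simple_rv_cst.
  apply: Ex_ae; [by apply: (proj1 (_ : bounded_rv P _)); bounded..|].
  move: admissible_ae; apply: filterS => w aw.
  by rewrite mul1r quantizer_second_moment// x_bounded.
(* Expanded so that the middle term is the noise against a known state, which has mean 0. *)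
have -> : Ex (fun w => (q t i w - x t i w) ^+ 2) =
    Ex (fun w => q t i w ^+ 2 - 2 * (x t i w * (q t i w - x t i w)) - x t i w ^+ 2).
  by apply: eq_Rintegral => w _; ring.
rewrite ExB ?ExB ?ExZ; [|bounded..].
rewrite e0 e1 ExD; [|bounded..].
by ring.
Qed.

(** One noise is not observed when the other is drawn, so [Ex_noise] does not suffice: conditional
    independence gives the mean of [q t i * q t j], and the remaining terms are noises against known
    states. *)
Lemma Ex_noiseM t i j : i != j ->
  Ex (fun w => (q t i w - x t i w) * (q t j w - x t j w)) = 0.
Proof.
move=> ij; have FT : obs t.+1 t t setT by exact: generated_setT.
have ei := Ex_noise j (x_simple t.+1 i (leqnn t) (leqnn t)).
have ej := Ex_noise i (x_simple t.+1 j (leqnn t) (leqnn t)).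
have cross (k l : int) :
    Ex (fun w => \1_(q t i @^-1` [set k%:~R]) w * \1_(q t j @^-1` [set l%:~R]) w) =
    Ex (fun w => quantizer_prob (x t i w) k * quantizer_prob (x t j w) l).
  (* Conditional independence for the pair of nodes, integrated over the whole space; [i] receives
     level [k] and [j] level [l]. *)
  have [_ hq2 /(_ t)] := hq.
  move=> /(_ [set i; j]%SET (fun h => if h == i then [set k%:~R] else [set l%:~R])
    (fun h w => quantizer_prob (x t h w) (if h == i then k else l))).
  case=> [h _|h _|_ /(_ setT FT)].
  - by case: ifP.
  - by case: ifP => _; exact: hq2.
  rewrite setTI => Pkl.
  transitivity (fine (P (q t i @^-1` [set k%:~R] `&` q t j @^-1` [set l%:~R]))).
    rewrite -Ex_indic; last exact: measurableI.
    by apply: eq_Rintegral => w _; rewrite !indicE in_setI -mulnb natrM.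
  transitivity (fine (P (\bigcap_(h in [set` [set i; j]%SET])
      (q t h @^-1` (if h == i then [set k%:~R] else [set l%:~R]))))).
    congr (fine (P _)); apply/seteqP; split => w /=.
      move=> [wi wj] h /=; rewrite !inE => /orP[/eqP ->|/eqP ->]; rewrite ?eqxx//.
      by rewrite eq_sym (negbTE ij).
    move=> wh; split; first by have := wh i; rewrite /= set21 eqxx; exact.
    by have := wh j; rewrite /= set22 eq_sym (negbTE ij); exact.
  rewrite -Pkl; congr fine; apply: eq_integral => w _; congr EFin.
  by rewrite big_setU1 ?inE//= big_set1 eqxx eq_sym (negbTE ij).
have eq : Ex (fun w => q t i w * q t j w) = Ex (fun w => x t i w * x t j w).
  pose K := int_range M.
  transitivity (Ex (fun w => \sum_(k <- K) \sum_(l <- K) (k%:~R * l%:~R) *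
      (\1_(q t i @^-1` [set k%:~R]) w * \1_(q t j @^-1` [set l%:~R]) w))).
    apply: Ex_ae; [by apply: (proj1 (_ : bounded_rv P _)); bounded..|].
    move: admissible_ae; apply: filterS => w aw.
    rewrite (quantized_decomp id t i aw) (quantized_decomp id t j aw) mulr_suml.
    apply: eq_bigr => k _; rewrite mulr_sumr; apply: eq_bigr => l _.
    by rewrite mulrACA.
  transitivity (Ex (fun w => \sum_(k <- K) \sum_(l <- K) (k%:~R * l%:~R) *
      (quantizer_prob (x t i w) k * quantizer_prob (x t j w) l))).
    rewrite !Ex_sum; [|by move=> k; bounded..].
    apply: eq_bigr => k _; rewrite !Ex_sum; [|by move=> l; bounded..].
    by apply: eq_bigr => l _; rewrite !ExZ ?cross//; bounded.
  apply: Ex_ae; [by apply: (proj1 (_ : bounded_rv P _)); bounded..|].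
  move: admissible_ae; apply: filterS => w aw.
  rewrite -[in RHS](quantizer_mean (x_bounded aw t i)).
  rewrite -[in RHS](quantizer_mean (x_bounded aw t j)).
  rewrite mulr_suml; apply: eq_bigr => k _; rewrite mulr_sumr.
  by apply: eq_bigr => l _; rewrite mulrACA.
have -> : Ex (fun w => (q t i w - x t i w) * (q t j w - x t j w)) =
    Ex (fun w => q t i w * q t j w - x t i w * x t j w -
       x t i w * (q t j w - x t j w) - x t j w * (q t i w - x t i w)).
  by apply: eq_Rintegral => w _; ring.
rewrite ExB ?ExB ?ExB; [|bounded..].
by rewrite ei ej eq; ring.
Qed.

(** * Drift of the total and of the Lyapunov function *)

Hypothesis hWpos : forall e, e \in E -> 0 < W e.

Definition total t w := \sum_h x t h w.
(** The coefficient [2] makes the growth of [total ^ 2] under the noise exceed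
    that of the sum of squares. *)
Definition lyapunov t w := \sum_h x t h w ^+ 2 - 2 * total t w ^+ 2.

Let total_bounded t : bounded_rv P (total t).
Proof. by rewrite /total; bounded. Qed.

Let lyapunov_bounded t : bounded_rv P (lyapunov t).
Proof. by have bS := total_bounded t; rewrite /lyapunov; bounded. Qed.

Let energy_bounded t i j : bounded_rv P (fun w => edge_energy (x t i w) (x t j w)).
Proof. by rewrite /edge_energy; bounded. Qed.

Let sel_indic_bounded t e : bounded_rv P \1_(sel t @^-1` [set e]).
Proof. exact: bounded_rv_indic. Qed.

(** A general [f] lets one lemma serve both the total and the sum of squares. *)
Lemma sum_step (f : R -> R) t i j w : i != j -> sel t w = [set i; j]%SET ->
  \sum_h f (x t.+1 h w) = \sum_h f (x t h w) +
    (f (2^-1 * x t i w + 2^-1 * q t j w) - f (x t i w)) +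
    (f (2^-1 * x t j w + 2^-1 * q t i w) - f (x t j w)).
Proof.
move=> ij selt; have [/(_ i j ij selt)[xi xj] h2] := hx t w.
have split g : \sum_h g h = g i + (g j + \sum_(h | (h != i) && (h != j)) g h) :> R.
  by rewrite (bigD1 i)//= (bigD1 j)//= eq_sym.
rewrite !split xi xj.
rewrite (eq_bigr (fun h => f (x t h w))) => [|h /andP[hi hj]]; first by ring.
by rewrite h2// selt !inE negb_or hi.
Qed.

(** By independence the constant [W e] is a conditional probability of selecting [e] given all that
    precedes the selection, quantized values at time [t] included. *)
Lemma Ex_sel t e (Z : T -> R) : e \in E -> simple_rv P (obs t.+1 t.+1 t) Z ->
  Ex (fun w => Z w * \1_(sel t @^-1` [set e]) w) = W e * Ex Z.
Proof.
move=> eE sZ; have bZ := simple_rv_bounded (@obs_m _ _ _) sZ.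
have [_ _ PW ind] := hsel.
have WeP A : obs t.+1 t.+1 t A ->
    (\int[P]_(w in A) (W e)%:E = P (A `&` sel t @^-1` [set e]))%E.
  move=> FA; rewrite integral_cst ?PW//; last exact: obs_m FA.
  by rewrite [RHS](ind t A e FA) PW// muleC.
rewrite (Ex_simple_cond (@obs_m _ _ _) (msel t e) (bounded_rv_cst P (W e)) WeP sZ).
by rewrite -ExZ//; apply: eq_Rintegral => w _; rewrite mulrC.
Qed.

(** On this event the total changes by half the sum of the two noises, each of mean 0. *)
Lemma Ex_total_edge t i j : [set i; j]%SET \in E ->
  Ex (fun w => (total t.+1 w - total t w) * \1_(sel t @^-1` [set [set i; j]%SET]) w) = 0.
Proof.
move=> ijE; have ij := simple_graph_neq hE ijE.
have FT : obs t.+1 t.+1 t setT by exact: generated_setT.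
have FI : setI_closed (obs t.+1 t.+1 t) by exact: generated_setI_closed.
have FT' : obs t.+1 t t setT by exact: generated_setT.
have sx h := x_simple t.+1 h (leqnSn t) (leqnn t).
have sq h := q_simple t.+1 t h (ltnSn t).
pose Z w := 2^-1 * ((q t i w - x t i w) + (q t j w - x t j w)).
have sZ : simple_rv P (obs t.+1 t.+1 t) Z.
  apply: simple_rvM => //; first exact: simple_rv_cst.
  by apply: simple_rvD => //; apply: simple_rvB.
transitivity (Ex (fun w => Z w * \1_(sel t @^-1` [set [set i; j]%SET]) w)).
  apply: eq_Rintegral => w _; rewrite indicE.
  have [|_] := boolP (w \in _); last by rewrite !mulr0.
  rewrite inE /= => selw; rewrite !mulr1 /total /Z (sum_step id ij selw)/=; lra.
rewrite (Ex_sel ijE sZ) /Z ExZ; [|bounded..]; rewrite ExD; [|bounded..].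
have e0 h : Ex (fun w => q t h w - x t h w) = 0.
  rewrite -[RHS](@Ex_noise t h (fun=> 1)); last exact: simple_rv_cst.
  by apply: eq_Rintegral => w _; rewrite mul1r.
by rewrite !e0; ring.
Qed.

Lemma Ex_lyapunov_edge t i j : [set i; j]%SET \in E ->
  Ex (fun w => (lyapunov t.+1 w - lyapunov t w) *
    \1_(sel t @^-1` [set [set i; j]%SET]) w) =
  - (W [set i; j]%SET * Ex (fun w => edge_energy (x t i w) (x t j w))).
Proof.
move=> ijE; have ij := simple_graph_neq hE ijE.
have FT : obs t.+1 t.+1 t setT by exact: generated_setT.
have FI : setI_closed (obs t.+1 t.+1 t) by exact: generated_setI_closed.
have sx h := x_simple t.+1 h (leqnSn t) (leqnn t).
have sq h := q_simple t.+1 t h (ltnSn t).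
have bS := total_bounded t.
pose Y w := 2^-1 * (x t i w + x t j w) - 2 * total t w.
(* Two sigma-algebras are needed: one containing [q t], for [Ex_sel], and one before [q t] is drawn,
   for [Ex_noise]. *)
have sY nx nq ns : (t <= nq)%N -> (t <= ns)%N -> simple_rv P (obs nx nq ns) Y.
  move=> tq ts.
  have GT : obs nx nq ns setT by exact: generated_setT.
  have GI : setI_closed (obs nx nq ns) by exact: generated_setI_closed.
  have sh h := x_simple nx h tq ts.
  apply: simple_rvB => //; apply: simple_rvM => //; try exact: simple_rv_cst.
    exact: simple_rvD.
  exact: simple_rv_sum.
have bY : bounded_rv P Y by rewrite /Y; bounded.
(* The exact increment when this edge is selected, sorted by powers of the noises. The squared
   noises get 1/4 from the sum of squares and -1/2 from the total; the linear terms have the known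
   coefficient [Y]. In the mean only the first two groups survive. *)
pose G w := (- 2^-1 * (x t i w - x t j w) ^+ 2 -
   4^-1 * ((q t i w - x t i w) ^+ 2 + (q t j w - x t j w) ^+ 2)) +
   (Y w * (q t i w - x t i w) + Y w * (q t j w - x t j w)) -
   (q t i w - x t i w) * (q t j w - x t j w).
have sG : simple_rv P (obs t.+1 t.+1 t) G.
  have sYt := sY t.+1 t.+1 t (leqnSn t) (leqnn t).
  have sd h : simple_rv P (obs t.+1 t.+1 t) (fun w => q t h w - x t h w).
    exact: simple_rvB.
  apply: simple_rvB => //; last exact: simple_rvM.
  apply: simple_rvD => //; last by apply: simple_rvD => //; exact: simple_rvM.
  apply: simple_rvB => //; apply: simple_rvM => //; try exact: simple_rv_cst.
    by apply: simple_rvX2 => //; exact: simple_rvB.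
  by apply: simple_rvD => //; exact: simple_rvX2.
transitivity (Ex (fun w => G w * \1_(sel t @^-1` [set [set i; j]%SET]) w)).
  apply: eq_Rintegral => w _; rewrite indicE.
  have [|_] := boolP (w \in _); last by rewrite !mulr0.
  rewrite inE /= => selw; rewrite !mulr1 /G /Y /lyapunov.
  rewrite (sum_step (fun a => a ^+ 2) ij selw) {1}/total (sum_step id ij selw)/=.
  by rewrite -/(total t w); field.
rewrite (Ex_sel ijE sG).
have eY : Ex (fun w => Y w * (q t i w - x t i w) + Y w * (q t j w - x t j w)) = 0.
  have sY' := sY t.+1 t t (leqnn t) (leqnn t).
  by rewrite ExD; [|bounded..]; rewrite (Ex_noise i sY') (Ex_noise j sY') addr0.
rewrite -mulrN; congr (_ * _); rewrite /G /edge_energy.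
rewrite ExB; [|bounded..]; rewrite Ex_noiseM//.
rewrite ExD; [|bounded..]; rewrite eY.
rewrite ExB; [|bounded..]; rewrite !ExZ; [|bounded..].
rewrite ExD; [|bounded..]; rewrite !Ex_noise2.
rewrite ExD; [|bounded..]; rewrite !ExZ; [|bounded..].
by rewrite ExD; [|bounded..]; ring.
Qed.

Lemma Ex_split_sel t (f : T -> R) : bounded_rv P f ->
  Ex f = \sum_(e in E) Ex (fun w => f w * \1_(sel t @^-1` [set e]) w).
Proof.
move=> bf; rewrite -Ex_sum; last by move=> e; bounded.
apply: eq_Rintegral => w _; rewrite (bigD1 (sel t w))//= big1 => [|e /andP[_ ew]].
  by rewrite indicE mem_set//= mulr1 addr0.
by rewrite indicE memNset ?mulr0//= => we; rewrite -we eqxx in ew.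
Qed.

Lemma Ex_total t : Ex (total t) = \sum_i x0 i.
Proof.
elim: t => [|t IH].
  rewrite -[RHS](Ex_cst P); apply: eq_Rintegral => w _.
  by apply: eq_bigr => i _; rewrite hx0.
rewrite -IH; apply/eqP; rewrite -subr_eq0 -ExB// (@Ex_split_sel t); last bounded.
apply/eqP/big1 => e eE; have /eqP/cards2P[i [j [_ eij]]] := hE eE.
by rewrite eij in eE *; exact: Ex_total_edge.
Qed.

Lemma Ex_energy_le t i j : [set i; j]%SET \in E ->
  W [set i; j]%SET * Ex (fun w => edge_energy (x t i w) (x t j w)) <=
  Ex (lyapunov t) - Ex (lyapunov t.+1).
Proof.
move=> ijE; rewrite -opprB -ExB// [Ex (fun w => lyapunov _ w - _)](@Ex_split_sel t); last bounded.
rewrite (bigD1 _ ijE)/= (Ex_lyapunov_edge t ijE) opprD opprK lerDl oppr_ge0.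
apply: sumr_le0 => e /andP[eE _]; have /eqP/cards2P[a [b [_ eab]]] := hE eE.
rewrite eab in eE *; rewrite (Ex_lyapunov_edge t eE) oppr_le0 mulr_ge0 ?(ltW (hWpos eE))//.
by apply: Rintegral_ge0 => w _; exact: edge_energy_ge0.
Qed.

Lemma lyapunov_norm_le w t : admissible w ->
  `|lyapunov t w| <= N%:R * M%:R ^+ 2 + 2 * (N%:R * M%:R) ^+ 2.
Proof.
move=> aw; have xM := x_bounded aw t.
have sumM (f : 'I_N -> R) (c : R) : (forall i, `|f i| <= c) -> `|\sum_i f i| <= N%:R * c.
  move=> fc; apply: le_trans (ler_norm_sum _ _ _) _.
  by apply: le_trans (ler_sum _ (fun i _ => fc i)) _; rewrite sumr_const card_ord mulr_natl.
rewrite /lyapunov (le_trans (ler_normB _ _))// lerD//.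
  by apply: sumM => i; rewrite normrX lerXn2r ?nnegrE.
rewrite normrM (ger0_norm (ler0n _ _)) ler_wpM2l// normrX lerXn2r ?nnegrE ?mulr_ge0//.
exact: sumM.
Qed.

Lemma energy_cvg0_ae i j : [set i; j]%SET \in E ->
  \forall w \ae P, edge_energy (x t i w) (x t j w) @[t --> \oo] --> 0.
Proof.
move=> ijE; have W0 := hWpos ijE.
pose C : R := N%:R * M%:R ^+ 2 + 2 * (N%:R * M%:R) ^+ 2.
have lyC t : `|Ex (lyapunov t)| <= C.
  apply: Ex_norm_le; first by case: (lyapunov_bounded t).
  by move: admissible_ae; apply: filterS => w; exact: lyapunov_norm_le.
(* The expected drops of [lyapunov] telescope to at most [C + C]; the edge energy enters them with
   weight [W], hence the inverse. *)
apply: (summable_Ex_cvg0 (C := (W [set i; j]%SET)^-1 * (C + C))) => //.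
  by move=> t w; exact: edge_energy_ge0.
move=> n; rewrite -[leLHS](mulKf (lt0r_neq0 W0)) ler_pM2l ?invr_gt0// mulr_sumr.
apply: (@le_trans _ _ (\sum_(t < n) (Ex (lyapunov t) - Ex (lyapunov t.+1)))).
  by apply: ler_sum => t _; exact: Ex_energy_le.
have -> : \sum_(t < n) (Ex (lyapunov t) - Ex (lyapunov t.+1)) =
    Ex (lyapunov 0) - Ex (lyapunov n).
  elim: n => [|n IH]; first by rewrite big_ord0 subrr.
  by rewrite big_ord_recr/= IH; ring.
by have := lyC 0%N; have := lyC n; rewrite !ler_norml; lra.
Qed.

End Gossip.

(** * The integer limit and its mean *)

Unset Implicit Arguments.

Theorem theorem5p2 (d : measure_display) (T : measurableType d) (R : realType)
    (P : probability T R) (N : nat)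
    (E : {set {set 'I_N}}) (W : {set 'I_N} -> R)
    (x0 : 'I_N -> R) (x q : nat -> 'I_N -> {RV P >-> R})
    (sel : nat -> T -> {set 'I_N})
    (hE : simple_graph E) (hconn : connected_graph E)
    (hWpos : forall e, e \in E -> 0 < W e)
    (hWsum : \sum_(e in E) W e = 1)
    (hsel : random_edge_selection E W x q sel)
    (hq : probabilistic_quantization x q sel)
    (hx0 : forall i w, x 0%N i w = x0 i)
    (hx : partially_quantized_gossip (fun t i w => x t i w)
            (fun t i w => q t i w) sel) :
  exists alpha : {RV P >-> R},
    [/\ forall w, alpha w \is a Num.int,
        ('E_P[alpha] = (average x0)%:E)%E &
        \forall w \ae P, forall i : 'I_N, x t i w @[t --> \oo] --> alpha w].
Proof.
have [e0 e0E] : exists e0, e0 \in E.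
  apply/set0Pn/eqP => E0; move: hWsum; rewrite E0 big_set0 => /esym/eqP.
  by rewrite oner_eq0.
have /eqP/cards2P[i0 [j0 [i0j0 e0ij]]] := hE _ e0E.
have N0 : (0 < N)%N by exact: leq_ltn_trans (ltn_ord i0).
pose M := Num.bound (\sum_i `|x0 i|).
have hM i : `|x0 i| <= M%:R.
  apply: le_trans (ltW (archi_boundP _)); last exact: sumr_ge0.
  by rewrite (bigD1 i)//= lerDl sumr_ge0.
have adm := admissible_ae hsel hq.
(* The upper limit and the floor make the candidate measurable and integer-valued at every sample
   point; on convergent paths the limit is an integer, which the floor leaves unchanged. *)
pose f w : R := (Num.floor (fine (limn_esup (fun t => (x t i0 w)%:E))))%:~R.
have mf : measurable_fun setT f.
  apply: (measurableT_comp (@measurable_floor R)).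
  apply: (measurableT_comp (fine_measurable measurableT)).
  by apply: measurable_fun_limn_esup => t; exact/measurable_EFinP.
have fx : \forall w \ae P, forall i, x t i w @[t --> \oo] --> f w.
  have en : \forall w \ae P, forall i j, [set i; j]%SET \in E ->
      edge_energy (x t i w) (x t j w) @[t --> \oo] --> 0.
    apply: filter_forall => i; apply: filter_forall => j.
    have [ijE|_] := boolP ([set i; j]%SET \in E); last exact: aeW.
    have := energy_cvg0_ae hE hsel hq hx0 hx hM hWpos ijE.
    by apply: filterS => w ? _.
  move: adm en; apply: filterS2 => w aw en.
  have [selE _ _ _] := hsel; have [q_int _ _] := hq.
  have [//|//|||k kx] := @gossip_path_cvg R N E hE hconn e0 e0E
      (fun t i => x t i w) (fun t i => q t i w) (fun t => sel t w) _ _ _ _ en.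
  - move=> t i; have /intrP[k qk] := q_int t i w.
    have /andP[k1 k2] := aw t i k qk; rewrite qk.
    have := floor_bounds (x t i w) => /andP[f1 f2].
    have k1' : (Num.floor (x t i w))%:~R <= k%:~R :> R by rewrite ler_int.
    have k2' : k%:~R < x t i w + 1.
      apply: le_lt_trans (_ : (Num.ceil (x t i w))%:~R < _); first by rewrite ler_int.
      by have := ceil_itv (x t i w); rewrite intrB => /andP[? _]; lra.
    by rewrite ltr_norml; apply/andP; split; lra.
  - by move=> t u; exact: hx.
  move=> i; rewrite /f is_cvg_limn_esupE; last first.
    by apply/cvg_ex; exists (k%:~R)%:E; exact/cvg_EFin/kx/nearW.
  rewrite (cvg_lim _ (_ : (x t i0 w)%:E @[t --> \oo] --> (k%:~R)%:E))//=.
    by rewrite intrKfloor.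
  by apply: cvg_EFin; [exact: nearW|exact: kx].
pose alpha : {RV P >-> R} := HB.pack f (isMeasurableFun.Build _ _ _ _ f mf).
exists alpha; split => //; first by move=> w; exact: intr_int.
rewrite expectation_def.
(* The averages have constant expectation by [Ex_total] and norm at most [M] almost surely, so
   dominated convergence passes that constant to the limit. *)
pose g t w := ((N%:R)^-1 * \sum_i x t i w)%:E.
have mg t : measurable_fun setT (g t).
  apply/measurable_EFinP; apply: measurable_funM => //.
  exact: measurable_sum.
have [] := @dominated_convergence _ _ _ P setT measurableT g (EFin \o f) (cst M%:R%:E) mg.
- exact/measurable_EFinP.
- move: fx; apply: filterS => w fx _; apply: cvg_EFin; first exact: nearW.
  rewrite (_ : f w = N%:R^-1 * \sum_(i < N) f w); last first.
    by rewrite sumr_const card_ord -[f w *+ N]mulr_natl mulKf// pnatr_eq0 -lt0n.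
  apply: cvgM; first exact: cvg_cst.
  by apply: cvg_big => [|i _]; [exact: add_continuous|exact: fx].
- exact/finite_measure_integrable_cst.
- move: adm; apply: filterS => w aw t _.
  have xM := x_bounded hE hsel hq hx0 hx hM aw t.
  rewrite /g lee_fin normrM ger0_norm// ler_pdivrMl ?ltr0n//.
  apply: le_trans (ler_norm_sum _ _ _) _.
  by apply: le_trans (ler_sum _ (fun i _ => xM i)) _; rewrite sumr_const card_ord mulr_natl.
move=> _ _ cvg.
have gE t : (\int[P]_w g t w = (average x0)%:E)%E.
  rewrite /g /average -(Ex_total hE hsel hq hx0 hx hM t) mulrC.
  have bS : bounded_rv P (total x t).
    by apply: bounded_rv_sum => i; exact: (x_bounded_rv hE hsel hq hx0 hx hM t i).
  rewrite -ExZ// fineK//; apply: integrable_fin_num => //.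
  by apply: bounded_rv_integrable; apply: bounded_rvM => //; exact: bounded_rv_cst.
by apply: (cvg_unique (@ereal_hausdorff R) cvg); apply: cvg_near_cst; apply: nearW.
Qed.
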